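(* Let $\mathbf{f}$ be a complex-valued function of two complex variables, with samples available at the scattered sampling points $\mathbf{S}=\{(X_1,Y_1),\ldots,(X_K,Y_K)\}\subset\mathbb{C}^2$ (coordinates may repeat: $X_i=X_j$ or $Y_i=Y_j$ for $i\neq j$ is allowed). Let $\boldsymbol{\lambda}=\{\lambda_1,\ldots,\lambda_n\}\subset\mathbb{C}$ and $\boldsymbol{\mu}=\{\mu_1,\ldots,\mu_m\}\subset\mathbb{C}$ be fixed sets of nodes, and let $\mathbf{I}=\{(\Lambda_1,\mathrm{M}_1),\ldots,(\Lambda_k,\mathrm{M}_k)\}\subset\boldsymbol{\lambda}\times\boldsymbol{\mu}$ be a set of $k$ interpolation points, at which $\mathbf{f}$ is also defined. Let $\mathcal{R}_{SI}$ be the set of admissible rational functions $$\mathcal{R}_{SI}=\left\{\frac{\mathbf{n}}{\mathbf{d}}\;\Big|\;\alpha\in\mathbb{C}^{n\times m},\ \beta_{\mathbf{u}}\in\mathbb{C}^{nm-k},\ \beta_{\mathbf{c}}=\alpha_{\mathbf{c}}\circ\mathbf{H}\ \text{and}\ \|\alpha\|_{\mathrm{F}}^2+\|\beta_{\mathbf{u}}\|_2^2=1\right\},$$ where $\mathbf{n},\mathbf{d},\alpha_{\mathbf{c}},\beta_{\mathbf{c}},\beta_{\mathbf{u}},\mathbf{H}$ are as defined in the context. Then $$\min_{\mathbf{n}/\mathbf{d}\in\mathcal{R}_{SI}}\ \sum_{i=1}^{K}\left|\mathbf{f}(X_i,Y_i)\,\mathbf{d}(X_i,Y_i)-\mathbf{n}(X_i,Y_i)\right|^2=\min_{\|\alpha\|_{\mathrm{F}}^2+\|\beta_{\mathbf{u}}\|_2^2=1}\left\|\mathbb{M}\begin{bmatrix}\mathrm{vec}(\alpha)\\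 \beta_{\mathbf{u}}\end{bmatrix}\right\|_2^2,$$ where $\mathbb{M}\in\mathbb{C}^{K\times(2nm-k)}$ is given by $$\mathbb{M}=\begin{bmatrix}\mathcal{D}\left(\mathcal{C}_{\boldsymbol{\lambda}}(\mathbf{X})\odot\mathcal{C}_{\boldsymbol{\mu}}(\mathbf{Y})\right)^\top-\left(\mathcal{C}_{\boldsymbol{\lambda}}(\mathbf{X})\odot\mathcal{C}_{\boldsymbol{\mu}}(\mathbf{Y})\right)^\top\mathcal{H},& -\left(\mathcal{C}_{\boldsymbol{\lambda}}(\mathbf{X})\odot\mathcal{C}_{\boldsymbol{\mu}}(\mathbf{Y})\right)^\top\mathcal{S}_{\mathbf{u}}^\top\end{bmatrix}.$$
   Context: The nodes $\lambda_1,\ldots,\lambda_n$ are distinct, and so are $\mu_1,\ldots,\mu_m$ and the points of $\mathbf{I}$. Basis functions: $g_{\boldsymbol{\lambda}}^{(i)}(x)=\frac{1}{x-\lambda_i}$ if $x\notin\boldsymbol{\lambda}$, $=1$ if $x=\lambda_i$, and $=0$ otherwise (i.e. $x\in\boldsymbol{\lambda}$, $x\ne\lambda_i$). Likewise $g_{\boldsymbol{\mu}}^{(j)}(y)=\frac{1}{y-\mu_j}$ if $y\notin\boldsymbol{\mu}$, $=1$ if $y=\mu_j$, and $=0$ otherwise. For coefficient matrices $\alpha,\beta\in\mathbb{C}^{n\times m}$ the barycentric numerator and denominator are $$\mathbf{n}(x,y)=\sum_{i=1}^n\sum_{j=1}^m\beta_{ij}\,g_{\boldsymbol{\lambda}}^{(i)}(x)\,g_{\boldsymbol{\mu}}^{(j)}(y),\qquad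 \mathbf{d}(x,y)=\sum_{i=1}^n\sum_{j=1}^m\alpha_{ij}\,g_{\boldsymbol{\lambda}}^{(i)}(x)\,g_{\boldsymbol{\mu}}^{(j)}(y).$$ An element $\mathbf{n}/\mathbf{d}$ of an admissible set is understood as the (formal) pair $(\mathbf{n},\mathbf{d})$ determined by admissible coefficients, so minimizing over the admissible set means minimizing over all admissible coefficients. Vectorization is row-wise: for $\alpha\in\mathbb{C}^{n\times m}$, $\mathrm{vec}(\alpha)=[\alpha_{11},\alpha_{12},\ldots,\alpha_{1m},\alpha_{21},\ldots,\alpha_{nm}]^\top\in\mathbb{C}^{nm}$. $\circ$ is the entrywise (Hadamard) product, $\odot$ the Khatri–Rao (column-wise Kronecker) product, i.e. column $l$ of $A\odot B$ is the Kronecker product of column $l$ of $A$ with column $l$ of $B$. For a vector $v$, $\mathrm{diag}(v)$ is the diagonal matrix with diagonal $v$. $^\top$ is the transpose without conjugation. $\mathbf{X}=[X_1,\ldots,X_K]^\top$, $\mathbf{Y}=[Y_1,\ldots,Y_K]^\top$. $\mathcal{C}_{\boldsymbol{\lambda}}(\mathbf{X})\in\mathbb{C}^{n\times K}$ has $(i,l)$ entry $g_{\boldsymbol{\lambda}}^{(i)}(X_l)$, and $\mathcal{C}_{\boldsymbol{\mu}}(\mathbf{Y})\in\mathbb{C}^{m\times K}$ has $(j,l)$ entry $g_{\boldsymbol{\mu}}^{(j)}(Y_l)$. $\mathcal{D}=\mathrm{diag}(\mathbf{f}(X_1,Y_1),\ldots,\mathbf{f}(X_K,Y_K))\in\mathbb{C}^{K\times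 K}$. Selection operators: let $\mathbf{M}_{\mathbf{c}}\in\mathbb{C}^{n\times m}$ have $(i,j)$ entry $1$ if $(\lambda_i,\mu_j)\in\mathbf{I}$ and $0$ otherwise, and let $\mathbf{M}_{\mathbf{u}}\in\mathbb{C}^{n\times m}$ have $(i,j)$ entry $0$ if $(\lambda_i,\mu_j)\in\mathbf{I}$ and $1$ otherwise. Let $\mathbf{c}_1<\cdots<\mathbf{c}_k$ be the indices $i$ with $\mathrm{vec}(\mathbf{M}_{\mathbf{c}})_i=1$ and $\mathbf{u}_1<\cdots<\mathbf{u}_{nm-k}$ the indices $i$ with $\mathrm{vec}(\mathbf{M}_{\mathbf{u}})_i=1$. Then $\mathcal{S}_{\mathbf{c}}\in\mathbb{R}^{k\times nm}$ has $(i,j)$ entry $1$ if $\mathbf{c}_i=j$ and $0$ otherwise, and $\mathcal{S}_{\mathbf{u}}\in\mathbb{R}^{(nm-k)\times nm}$ has $(i,j)$ entry $1$ if $\mathbf{u}_i=j$ and $0$ otherwise. Put $\alpha_{\mathbf{c}}=\mathcal{S}_{\mathbf{c}}\mathrm{vec}(\alpha)\in\mathbb{C}^k$, $\beta_{\mathbf{c}}=\mathcal{S}_{\mathbf{c}}\mathrm{vec}(\beta)\in\mathbb{C}^k$, $\beta_{\mathbf{u}}=\mathcal{S}_{\mathbf{u}}\mathrm{vec}(\beta)\in\mathbb{C}^{nm-k}$; then $\beta$ is recovered from $\beta_{\mathbf{c}},\beta_{\mathbf{u}}$ via $\mathrm{vec}(\beta)=\mathcal{S}_{\mathbf{c}}^\top\beta_{\mathbf{c}}+\mathcal{S}_{\mathbf{u}}^\top\beta_{\mathbf{u}}$.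 The points of $\mathbf{I}$ are enumerated in the order of the indices $\mathbf{c}_1,\ldots,\mathbf{c}_k$ (so that $\beta_{\mathbf{c}}=\alpha_{\mathbf{c}}\circ\mathbf{H}$ means $\beta_{ij}=\alpha_{ij}\mathbf{f}(\lambda_i,\mu_j)$ whenever $(\lambda_i,\mu_j)\in\mathbf{I}$), where $\mathbf{H}=[\mathbf{f}(\Lambda_1,\mathrm{M}_1),\ldots,\mathbf{f}(\Lambda_k,\mathrm{M}_k)]^\top\in\mathbb{C}^k$. Finally $\mathcal{H}=\mathrm{diag}(\mathcal{S}_{\mathbf{c}}^\top\mathbf{H})\in\mathbb{C}^{nm\times nm}$. *)

(* Defs.v *)
From HB Require Import structures.
From mathcomp Require Import all_boot all_order all_algebra.
From mathcomp Require Import boolp classical_sets reals.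
From mathcomp Require Import complex mxtens.

Set Implicit Arguments.
Unset Strict Implicit.
Unset Printing Implicit Defensive.

Import Order.TTheory GRing.Theory Num.Theory.

Local Open Scope ring_scope.
Local Open Scope complex_scope.
Local Open Scope classical_set_scope.

(* On R[i] the order is the partial one (x <= y iff y - x is a nonnegative
   real), so on sets of real values this is the minimum of a set of reals. *)
Definition is_min {d : Order.disp_t} {T : porderType d} (A : set T) (v : T) :
  Prop := A v /\ lbound A v.

Section LinearAlgebra.
Context {R : realType}.
Local Notation C := R[i].

(* Squared Frobenius norm; on a column vector, the squared 2-norm. *)
Definition normF2 {p q} (A : 'M[C]_(p, q)) : C :=
  \sum_(i < p) \sum_(j < q) `|A i j| ^+ 2.

Definition vec {n m} (A : 'M[C]_(n, m)) : 'cV[C]_(n * m) := (mxvec A)^T.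

Definition unvec {n m} (v : 'cV[C]_(n * m)) : 'M[C]_(n, m) := vec_mx v^T.

Definition hadamard {p q} (A B : 'M[C]_(p, q)) : 'M[C]_(p, q) :=
  map2_mx *%R A B.

Definition khatri_rao {n m K} (A : 'M[C]_(n, K)) (B : 'M[C]_(m, K)) :
  'M[C]_(n * m, K) := \matrix_(p, l) (col l A *t col l B) p 0.

Definition diag {p} (v : 'cV[C]_p) : 'M[C]_p := diag_mx v^T.

(* The (a, b) entry is 1 iff b is the a-th item of s. *)
Definition selection {N} (p : nat) (s : seq 'I_N) : 'M[C]_(p, N) :=
  \matrix_(a, b) (onth s a == Some b)%:R.

End LinearAlgebra.

Lemma index_allpairs_pair (T U : eqType) (s : seq T) (t : seq U) x y :
  x \in s -> y \in t ->
  index (x, y) [seq (a, b) | a <- s, b <- t] =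
    (index x s * size t + index y t)%N.
Proof.
move=> xs yt; elim: s xs => //= a s IHs; rewrite inE => xs.
have injp : injective (pair a : U -> T * U) by move=> u v [].
rewrite index_cat size_map; case: (eqVneq x a) xs => [<- _ | nax /= xs].
  by rewrite map_f // mul0n add0n index_map // => u v [].
rewrite (IHs xs); case: ifP => [/mapP[b _ [ax _]]|_].
  by rewrite ax eqxx in nax.
by rewrite mulSn addnA.
Qed.

(* mxvec, hence vec, is row-wise, in the row order of the product *t. *)
Lemma val_mxvec_index n m (i : 'I_n) (j : 'I_m) :
  mxvec_index i j = (i * m + j)%N :> nat.
Proof.
have -> : mxvec_index i j = index (i, j) (enum {: 'I_n * 'I_m}) :> nat.
  rewrite /mxvec_index /=; have := enum_rankK (i, j).
  set r := enum_rank _ => <-; rewrite /enum_val index_uniq ?enum_uniq //.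
  by rewrite -cardE.
rewrite enumT unlock /= /prod_enum index_allpairs_pair ?mem_enum //.
by rewrite size_enum_ord !index_enum_ord.
Qed.

Section Barycentric.
Context {R : realType} {n m k K : nat}.
Local Notation C := R[i].
Implicit Types (lambda : n.-tuple C) (mu : m.-tuple C).
Implicit Types (I : k.-tuple (C * C)) (S : K.-tuple (C * C)).
Implicit Types (f : C -> C -> C) (alpha beta : 'M[C]_(n, m)).

Definition basis {p} (nodes : p.-tuple C) (i : 'I_p) (x : C) : C :=
  if x \notin nodes then 1 / (x - tnth nodes i)
  else if x == tnth nodes i then 1 else 0.

(* The numerator for coefficients beta, the denominator for alpha. *)
Definition barycentric lambda mu (coef : 'M[C]_(n, m)) (x y : C) : C :=
  \sum_(i < n) \sum_(j < m) coef i j * basis lambda i x * basis mu j y.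

Definition cauchy_mx {p} (nodes : p.-tuple C) (x : K.-tuple C) :
  'M[C]_(p, K) := \matrix_(i, l) basis nodes i (tnth x l).

Definition mask_c lambda mu I : 'M[C]_(n, m) :=
  \matrix_(i, j) if (tnth lambda i, tnth mu j) \in I then 1 else 0.

Definition mask_u lambda mu I : 'M[C]_(n, m) :=
  \matrix_(i, j) if (tnth lambda i, tnth mu j) \in I then 0 else 1.

Definition indices_c lambda mu I : seq 'I_(n * m) :=
  [seq p <- enum 'I_(n * m) | vec (mask_c lambda mu I) p 0 == 1].

Definition indices_u lambda mu I : seq 'I_(n * m) :=
  [seq p <- enum 'I_(n * m) | vec (mask_u lambda mu I) p 0 == 1].

Definition Sc lambda mu I : 'M[C]_(k, n * m) :=
  selection k (indices_c lambda mu I).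

Definition Su lambda mu I : 'M[C]_(n * m - k, n * m) :=
  selection (n * m - k) (indices_u lambda mu I).

(* The points of I are listed in the order of the indices c_1 < ... < c_k. *)
Definition ordered_points lambda mu I : Prop :=
  forall (l : 'I_k) (i : 'I_n) (j : 'I_m),
    onth (indices_c lambda mu I) l = Some (mxvec_index i j) ->
    tnth I l = (tnth lambda i, tnth mu j).

Definition interp_values f I : 'cV[C]_k :=
  \col_l f (tnth I l).1 (tnth I l).2.

Definition unit_coefs (alpha : 'M[C]_(n, m)) (beta_u : 'cV[C]_(n * m - k)) :
  Prop := normF2 alpha + normF2 beta_u = 1.

(* n/d is encoded as the formal pair (n, d). *)
Definition R_SI f lambda mu I : set ((C -> C -> C) * (C -> C -> C)) :=
  [set nd | exists (alpha : 'M[C]_(n, m)) (beta_u : 'cV[C]_(n * m - k)),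
    let alpha_c := Sc lambda mu I *m vec alpha in
    let beta_c := hadamard alpha_c (interp_values f I) in
    let beta := unvec ((Sc lambda mu I)^T *m beta_c
                       + (Su lambda mu I)^T *m beta_u) in
    unit_coefs alpha beta_u /\
    nd = (barycentric lambda mu beta, barycentric lambda mu alpha)].

Definition sample_diag f S : 'M[C]_K :=
  diag (\col_l f (tnth S l).1 (tnth S l).2).

Definition interp_diag f lambda mu I : 'M[C]_(n * m) :=
  diag ((Sc lambda mu I)^T *m interp_values f I).

Definition LS_mx f lambda mu I S : 'M[C]_(K, n * m + (n * m - k)) :=
  let V := (khatri_rao (cauchy_mx lambda (map_tuple fst S))
                       (cauchy_mx mu (map_tuple snd S)))^T in
  row_mx (sample_diag f S *m V - V *m interp_diag f lambda mu I)
         (- (V *m (Su lambda mu I)^T)).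

End Barycentric.

(* Main.v *)
(* For admissible coefficients the constraint [beta_c = alpha_c o H] reads
   [vec beta = diag (Sc^T H) vec alpha + Su^T beta_u], so the vector of
   residuals [f d - n] at the samples is the least-squares matrix applied to
   the stacked coefficients, and both sides minimize the same values.  The
   minimum is attained because, after diagonalizing the Gram matrix
   [M^* M] by a unitary matrix, [|M z|^2] is a weighted mean of its
   eigenvalues for every unit vector [z]: the minimum is the smallest one. *)
Require Import Defs.
From mathcomp Require Import all_boot all_order all_algebra.
From mathcomp Require Import boolp classical_sets reals.
From mathcomp Require Import complex mxtens.

Import Order.TTheory GRing.Theory Num.Theory.

Local Open Scope ring_scope.
Local Open Scope complex_scope.
Local Open Scope classical_set_scope.
Local Open Scope sesquilinear_scope.

Section NormF2.
Context {R : realType}.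
Local Notation C := R[i].

(** The trace form turns unitary invariance and the passage to the Gram matrix into regrouping of
    matrix products. *)
Lemma normF2_trace {p q} (A : 'M[C]_(p, q)) : normF2 A = \tr (A ^t* *m A).
Proof.
rewrite /normF2 exchange_big; apply: eq_bigr => j _.
by rewrite mxE; apply: eq_bigr => i _; rewrite !mxE normCKC.
Qed.

Lemma normF2_cV {p} (z : 'cV[C]_p) : normF2 z = \sum_i `|z i 0| ^+ 2.
Proof. by apply: eq_bigr => i _; rewrite big_ord1. Qed.

Lemma normF2_col_mx {p q r} (A : 'M[C]_(p, r)) (B : 'M[C]_(q, r)) :
  normF2 (col_mx A B) = normF2 A + normF2 B.
Proof.
rewrite /normF2 big_split_ord; congr (_ + _); apply: eq_bigr => i _;
  by apply: eq_bigr => j _; rewrite (col_mxEu, col_mxEd).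
Qed.

Lemma normF2_vec {n m} (A : 'M[C]_(n, m)) : normF2 (vec A) = normF2 A.
Proof.
rewrite normF2_cV /normF2 pair_bigA /=.
rewrite (reindex _ (curry_mxvec_bij n m)) /=.
by apply: eq_bigr => -[i j] _ /=; rewrite mxE mxvecE.
Qed.

Lemma unvecK {n m} : cancel (@unvec R n m) vec.
Proof. by move=> v; rewrite /vec /unvec vec_mxK trmxK. Qed.

Lemma normF2_unitary {p} (U : 'M[C]_p) (z : 'cV[C]_p) :
  U \is unitarymx -> normF2 (U *m z) = normF2 z.
Proof.
rewrite -trmxC_unitary => /unitarymxP; rewrite trmxCK => UU.
by rewrite !normF2_trace trmx_mul map_mxM -mulmxA (mulmxA _ U) UU mul1mx.
Qed.

Lemma normF2_min {p q} (M : 'M[C]_(p, q)) : (0 < q)%N ->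
  exists v, is_min [set normF2 (M *m z)
                   | z in [set z : 'cV[C]_q | normF2 z = 1]] v.
Proof.
move=> q_gt0; pose G := M ^t* *m M; pose U := spectralmx G.
pose d := spectral_diag G.
have Gherm : G \is hermsymmx.
  by rewrite is_hermitianmxE expr0 scale1r trmx_mul map_mxM trmxCK.
have Uunit : U \is unitarymx := spectral_unitarymx G.
have UV : U *m U ^t* = 1%:M by apply/unitarymxP.
have GE : G = U ^t* *m diag_mx d *m U.
  by rewrite -invmx_unitary //; apply/orthomx_spectralP/hermitian_normalmx.
(* Since [z^* U^* = (U z)^*], the quadratic form of [G] is diagonal in the coordinates [U *m z]. *)
have normE (z : 'cV_q) : normF2 (M *m z) = \sum_i d 0 i * `|(U *m z) i 0| ^+ 2.
  rewrite normF2_trace trmx_mul map_mxM mulmxA -(mulmxA _ _ M) -/G GE.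
  rewrite !mulmxA -map_mxM -trmx_mul -!mulmxA.
  rewrite /mxtrace big_ord1 mxE; apply: eq_bigr => i _.
  by rewrite mul_diag_mx !mxE normCKC mulrCA.
(* The order on [R[i]] is only partial: realness makes the eigenvalues comparable, and [q_gt0]
   supplies one to start from. *)
have d_real i : d 0 i \is Num.real.
  by have /mxOverP/(_ 0 i) := hermitian_spectral_diag_real Gherm.
case: (@real_arg_minP _ _ (Ordinal q_gt0) xpredT (d 0)) => // i0 _ i0_min.
exists (d 0 i0); split.
  (* Column [i0] of [U ^t*] is a unit eigenvector for [d 0 i0]: [U] sends it to a basis vector,
     which puts all the weight on that eigenvalue. *)
  exists (U ^t* *m delta_mx i0 0).
    rewrite /= normF2_unitary ?trmxC_unitary // normF2_cV (bigD1 i0) //=.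
    rewrite big1 ?mxE ?eqxx ?normr1 ?expr1n ?addr0 // => i /negPf ni.
    by rewrite mxE ni normr0 expr0n.
  rewrite normE mulmxA UV mul1mx (bigD1 i0) //= big1.
    by rewrite mxE !eqxx normr1 expr1n mulr1 addr0.
  by move=> i /negPf ni; rewrite mxE ni normr0 expr0n mulr0.
(* The weights [|(U z)_i|^2] sum to 1, so [d 0 i0] is spread over them and compared term by term. *)
move=> _ [z /= z1 <-]; rewrite normE -[d 0 i0]mulr1 -z1 -(normF2_unitary _ _ Uunit).
rewrite normF2_cV mulr_sumr; apply: ler_sum => i _.
by rewrite ler_wpM2r ?exprn_ge0 // i0_min.
Qed.

End NormF2.

Section LeastSquares.
Context {R : realType} {n m k K : nat}.
Local Notation C := R[i].

(* Each row of a selection matrix has at most one nonzero entry, so the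
   off-diagonal entries of [S^T *m S] vanish. *)
Lemma selection_hadamard {N p} (s : seq 'I_N) (a : 'cV[C]_N) (h : 'cV[C]_p) :
  (selection p s)^T *m hadamard (selection p s *m a) h =
  diag ((selection p s)^T *m h) *m a.
Proof.
apply/colP => b; rewrite mul_diag_mx !mxE mulr_suml.
apply: eq_bigr => l _; rewrite !mxE.
have [sl|_] := eqVneq; last by rewrite !mul0r.
rewrite (bigD1 b) //= mxE sl eqxx big1 ?addr0 ?mul1r 1?mulrC // => c cb.
rewrite mxE sl; case: eqP => [[bc]|]; last by rewrite mul0r.
by rewrite bc eqxx in cb.
Qed.

Lemma barycentricE (lambda : n.-tuple C) (mu : m.-tuple C)
  (S : K.-tuple (C * C)) (coef : 'M[C]_(n, m)) (l : 'I_K) :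
  barycentric lambda mu coef (tnth S l).1 (tnth S l).2 =
  ((khatri_rao (cauchy_mx lambda (map_tuple fst S))
               (cauchy_mx mu (map_tuple snd S)))^T *m vec coef) l 0.
Proof.
rewrite mxE (reindex _ (curry_mxvec_bij n m)) /=.
rewrite /barycentric pair_bigA /=; apply: eq_bigr => -[i j] _ /=.
rewrite !mxE mxvecE.
(* Vectorization and the Kronecker product both number the pair [(i, j)] as [i * m + j]. *)
have -> : mxvec_index i j = mxtens_index (i, j).
  by apply: val_inj; exact: val_mxvec_index.
by rewrite mxtens_indexK !tnth_map [RHS]mulrC mulrA.
Qed.

(** With [V] the transposed Khatri-Rao matrix, [barycentricE] makes each residual an entry of
    [D V vec(alpha) - V vec(beta)]. By [selection_hadamard] the constrained part of [beta] is linear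
    in [vec alpha], which gives the two blocks. *)
Lemma sum_residualE (f : C -> C -> C) (S : K.-tuple (C * C))
  (lambda : n.-tuple C) (mu : m.-tuple C) (I : k.-tuple (C * C))
  (alpha : 'M[C]_(n, m)) (beta_u : 'cV[C]_(n * m - k)) :
  let alpha_c := Sc lambda mu I *m vec alpha in
  let beta_c := hadamard alpha_c (interp_values f I) in
  let beta := unvec ((Sc lambda mu I)^T *m beta_c
                     + (Su lambda mu I)^T *m beta_u) in
  \sum_(l < K) (let: (x, y) := tnth S l in
    `|f x y * barycentric lambda mu alpha x y
      - barycentric lambda mu beta x y| ^+ 2) =
  normF2 (LS_mx f lambda mu I S *m col_mx (vec alpha) beta_u).
Proof.
move=> alpha_c beta_c beta; rewrite normF2_cV; apply: eq_bigr => l _.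
case Sl: (tnth S l) => [x y].
have [-> ->] : x = (tnth S l).1 /\ y = (tnth S l).2 by rewrite Sl.
rewrite !barycentricE /LS_mx; move: (khatri_rao _ _)^T => V.
rewrite mul_row_col mulmxBl mulNmx -addrA -opprD -!mulmxA -mulmxDr.
rewrite -selection_hadamard -(unvecK (_ + _)) -/beta.
congr (`|_| ^+ 2); rewrite /sample_diag mul_diag_mx [RHS]mxE.
by congr (_ + _); rewrite [RHS]mxE //; congr (_ * _); rewrite 2!mxE.
Qed.

End LeastSquares.

Theorem theorem1 (R : realType) (n m k K : nat)
  (f : R[i] -> R[i] -> R[i])
  (S : K.-tuple (R[i] * R[i]))
  (lambda : n.-tuple R[i]) (mu : m.-tuple R[i])
  (I : k.-tuple (R[i] * R[i]))
  (n_gt0 : (0 < n)%N) (m_gt0 : (0 < m)%N)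
  (lambda_uniq : uniq lambda) (mu_uniq : uniq mu) (I_uniq : uniq I)
  (I_sub : forall p, p \in I -> p.1 \in lambda /\ p.2 \in mu)
  (I_ordered : ordered_points lambda mu I) :
  exists v : R[i],
    is_min [set \sum_(l < K)
                  (let: (x, y) := tnth S l in
                   `|f x y * nd.2 x y - nd.1 x y| ^+ 2)
           | nd in R_SI f lambda mu I] v /\
    is_min [set normF2 (LS_mx f lambda mu I S *m col_mx (vec ab.1) ab.2)
           | ab in [set ab : 'M[R[i]]_(n, m) * 'cV[R[i]]_(n * m - k) |
                    unit_coefs ab.1 ab.2]] v.
Proof.
set N := [set _ | _ in R_SI f lambda mu I].
set L := [set _ | _ in [set ab | unit_coefs ab.1 ab.2]].
have -> : N = L.
  apply/seteqP; split => [_ [_ [a [b [ab1 ->]]] <-]|_ [[a b] ab1 <-]].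
    by exists (a, b) => //; rewrite -[RHS]/(\sum_(l < K) _) sum_residualE.
  eexists; first by exists a, b.
  exact: sum_residualE.
have [|v minv] := normF2_min (LS_mx f lambda mu I S).
  by rewrite addn_gt0 muln_gt0 n_gt0 m_gt0.
(* Stacking is a bijection from coefficient pairs to vectors under which squared norms add, so
   [unit_coefs] becomes the unit sphere. *)
suff -> : L = [set normF2 (LS_mx f lambda mu I S *m z)
              | z in [set z : 'cV_(n * m + (n * m - k)) | normF2 z = 1]].
  by exists v.
apply/seteqP; split => [_ [[a b] ab1 <-]|_ [z z1 <-]].
  by exists (col_mx (vec a) b); rewrite //= normF2_col_mx normF2_vec.
exists (unvec (usubmx z), dsubmx z); rewrite /= ?unvecK ?vsubmxK //.
by rewrite /unit_coefs -normF2_vec unvecK -normF2_col_mx vsubmxK.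
Qed.
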